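(* Suppose $X$ is a compact Hausdorff space. The following are equivalent: (1) $X$ is a $\upsilon$-space. (2) Every additive zero-preserving map on $C(X)$ is $\mathbb{R}$-linear. (3) Every additive zero-preserving map on $C(X)$ is continuous. (4) Every additive zero-preserving map $T$ on $C(X)$ has the form $$T(f)=T(1)\operatorname{Re}(f)+T(i)\operatorname{Im}(f)\quad\text{for every } f\in C(X).$$ (5) Every additive zero-preserving map on $C_R(X)$ is a multiplication.
   Context: $C(X)$ and $C_R(X)$ denote the algebras of complex-valued, respectively real-valued, continuous functions on $X$, with the supremum norm. A map $T$ on $C(X)$ (or on $C_R(X)$) is additive if $T(f+g)=T(f)+T(g)$ for all $f,g$; it is zero-preserving if for every $f$ in the algebra and every $x\in X$, $f(x)=0$ implies $T(f)(x)=0$; it is a multiplication if there is an element $a$ of the algebra with $T(f)=af$ for all $f$. A compact Hausdorff space $X$ is defined to be a $\upsilon$-space if every zero-preserving additive map on $C_R(X)$ is a multiplication. *)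

(* Defs.v *)
From HB Require Import structures.
From mathcomp Require Import all_boot all_order all_algebra.
From mathcomp Require Import all_classical all_reals topology normedtype.
From mathcomp Require Export complex.

Set Implicit Arguments.
Unset Strict Implicit.
Unset Printing Implicit Defensive.

Import Order.TTheory GRing.Theory Num.Theory.
Import numFieldNormedType.Exports.

Local Open Scope classical_set_scope.
Local Open Scope ring_scope.
Local Open Scope complex_scope.

HB.mixin Record isCompactHausdorff X & Topological X := {
  compact_setT : compact [set: X] ;
  hausdorff_setT : hausdorff_space X
}.

#[short(type="compactHausdorffType")]
HB.structure Definition CompactHausdorff :=
  {X of isCompactHausdorff X & Topological X}.

(* [Rcomplex R] is the library's alias of [R[i]] carrying the modulus as an
   [R]-valued norm and the scaling by elements of [R]; it is given here the
   topology induced by that norm. *)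
Section Rcomplex_topology.
Variable R : realType.

HB.instance Definition _ :=
  PseudoMetric.copy (Rcomplex R) (pseudoMetric_normed (Rcomplex R)).
HB.instance Definition _ := isPointed.Build (Rcomplex R) 0.
HB.instance Definition _ :=
  NormedZmod_PseudoMetric_eq.Build R (Rcomplex R) erefl.

Lemma Rcomplex_normZ (l : R) (x : Rcomplex R) : `|l *: x| = `|l| * `|x|.
Proof.
case: x => a b; rewrite /Num.norm /=.
by rewrite !exprMn -mulrDr sqrtrM ?sqr_ge0// sqrtr_sqr.
Qed.

HB.instance Definition _ :=
  PseudoMetricNormedZmod_Lmodule_isNormedModule.Build R (Rcomplex R)
    Rcomplex_normZ.

End Rcomplex_topology.

Section pointwise_module.
Variables (R : numFieldType) (X : topologicalType) (V : normedModType R).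
Implicit Types f g : continuousType X V.

Let cts f : continuous f. Proof. exact: cts_fun. Qed.

Lemma ctsD_subproof f g : continuous (fun x => f x + g x).
Proof. by move=> x; exact: continuousD (@cts f x) (@cts g x). Qed.
Lemma ctsN_subproof f : continuous (fun x => - f x).
Proof. by move=> x; exact: continuousN (@cts f x). Qed.
Lemma ctsZ_subproof (a : R) f : continuous (fun x => a *: f x).
Proof. by move=> x; exact: cvgZr (@cts f x). Qed.

Definition cts_zero : continuousType X V := cst 0.
Definition cts_add f g : continuousType X V := mkcts (@ctsD_subproof f g).
Definition cts_opp f : continuousType X V := mkcts (@ctsN_subproof f).
Definition cts_scale (a : R) f : continuousType X V :=
  mkcts (@ctsZ_subproof a f).

Let addA : associative cts_add.
Proof. by move=> f g h; apply/continuousEP => x; apply: addrA. Qed.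
Let addC : commutative cts_add.
Proof. by move=> f g; apply/continuousEP => x; apply: addrC. Qed.
Let add0 : left_id cts_zero cts_add.
Proof. by move=> f; apply/continuousEP => x; apply: add0r. Qed.
Let addN : left_inverse cts_zero cts_opp cts_add.
Proof. by move=> f; apply/continuousEP => x; apply: addNr. Qed.

HB.instance Definition _ :=
  GRing.isZmodule.Build (continuousType X V) addA addC add0 addN.

Let scaleA a b f : cts_scale a (cts_scale b f) = cts_scale (a * b) f.
Proof. by apply/continuousEP => x; apply: scalerA. Qed.
Let scale1 : left_id 1 cts_scale.
Proof. by move=> f; apply/continuousEP => x; apply: scale1r. Qed.
Let scaleDr : right_distributive cts_scale +%R.
Proof. by move=> a f g; apply/continuousEP => x; apply: scalerDr. Qed.
Let scaleDl f : {morph cts_scale^~ f : a b / a + b}.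
Proof. by move=> a b; apply/continuousEP => x; apply: scalerDl. Qed.

HB.instance Definition _ :=
  GRing.Zmodule_isLmodule.Build R (continuousType X V)
    scaleA scale1 scaleDr scaleDl.

End pointwise_module.

Section supremum_norm.
Variables (R : realType) (X : compactHausdorffType) (V : normedModType R).
Implicit Types f g : continuousType X V.

(* For empty [X] this is [sup set0 = 0]. *)
Definition sup_norm f : R := sup [set `|f x| | x in [set: X]].

Lemma sup_norm_ub f x : `|f x| <= sup_norm f.
Proof.
have cf : compact [set `|f x| | x in [set: X]].
  apply: continuous_compact; last exact: compact_setT.
  apply: continuous_subspaceT => y.
  by apply: cvg_norm; apply: (@cts_fun _ _ f).
have [M [_ fM]] := compact_bounded cf.
apply: ub_le_sup; last by exists x.
exists (M + 1) => _ [y _ <-].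
by apply: le_trans (ler_norm _) (fM (M + 1) _ _ _); rewrite ?ltrDl//; exists y.
Qed.

Lemma sup_norm_le f M : 0 <= M -> (forall x, `|f x| <= M) -> sup_norm f <= M.
Proof.
move=> M0 fM; rewrite /sup_norm.
have [->|ne] := eqVneq [set `|f x| | x in [set: X]] set0; first by rewrite sup0.
by apply: ge_sup; [exact/set0P | move=> _ [x _ <-]].
Qed.

Lemma sup_norm_ge0 f : 0 <= sup_norm f.
Proof.
rewrite /sup_norm.
have [->|/set0P[_ [x _ _]]] := eqVneq [set `|f x| | x in [set: X]] set0.
  by rewrite sup0.
exact: le_trans (normr_ge0 _) (sup_norm_ub f x).
Qed.

Let normD f g : sup_norm (f + g) <= sup_norm f + sup_norm g.
Proof.
apply: sup_norm_le => [|x]; first by rewrite addr_ge0 ?sup_norm_ge0.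
by apply: le_trans (ler_normD (f x) (g x)) _; rewrite lerD ?sup_norm_ub.
Qed.

Let norm_scale_le a f : sup_norm (a *: f) <= `|a| * sup_norm f.
Proof.
apply: sup_norm_le => [|x]; first by rewrite mulr_ge0 ?sup_norm_ge0.
by rewrite [leLHS](normrZ a (f x)) ler_wpM2l ?sup_norm_ub.
Qed.

Let normZ a f : sup_norm (a *: f) = `|a| * sup_norm f.
Proof.
apply/eqP; rewrite eq_le norm_scale_le /=.
have [->|a0] := eqVneq a 0; first by rewrite normr0 mul0r sup_norm_ge0.
rewrite -ler_pdivlMl ?normr_gt0// -normfV.
by rewrite -[in leLHS](scale1r f) -(mulVf a0) -scalerA norm_scale_le.
Qed.

Let norm0_eq0 f : sup_norm f = 0 -> f = 0.
Proof.
move=> f0; apply/continuousEP => x; apply/normr0_eq0/eqP.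
by rewrite eq_le normr_ge0 andbT -f0 sup_norm_ub.
Qed.

HB.instance Definition _ :=
  Lmodule_isNormed.Build R (continuousType X V) normD normZ norm0_eq0.

End supremum_norm.

Section pointwise_product.
Variables (R : numFieldType) (X : topologicalType) (K : normedModType R).
Variable (mul : K -> K -> K).
Hypothesis mul_Bl : forall a, {morph mul a : x y / x - y}.
Hypothesis mul_Br : forall a, {morph mul^~ a : x y / x - y}.
Hypothesis normM : forall x y, `|mul x y| = `|x| * `|y|.
Implicit Types f g : continuousType X K.

Lemma ctsM_subproof f g : continuous (fun x => mul (f x) (g x)).
Proof.
move=> x.
have fx : f y @[y --> x] --> f x by apply: cts_fun.
have gx : g y @[y --> x] --> g x by apply: cts_fun.
apply/cvgrPdist_lt => e e0.
have M0 : 0 < `|f x| + `|g x| + 1 by rewrite ltr_wpDl// addr_ge0.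
have d0 : 0 < e / (`|f x| + `|g x| + 1) by rewrite divr_gt0.
near=> y.
have fy1 : `|f x - f y| < 1 by near: y; apply: cvgr_dist_lt.
have fy : `|f x - f y| < e / (`|f x| + `|g x| + 1).
  by near: y; apply: cvgr_dist_lt.
have gy : `|g x - g y| < e / (`|f x| + `|g x| + 1).
  by near: y; apply: cvgr_dist_lt.
have -> : mul (f x) (g x) - mul (f y) (g y)
    = mul (f x) (g x - g y) + mul (f x - f y) (g x)
      - mul (f x - f y) (g x - g y).
  by rewrite !mul_Bl !mul_Br -[RHS]addrA subKr addrA subrK.
apply: le_lt_trans (ler_normB _ _) _.
apply: le_lt_trans (lerD (ler_normD _ _) (lexx _)) _.
rewrite !normM.
have -> : e = `|f x| * (e / (`|f x| + `|g x| + 1))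
   + (e / (`|f x| + `|g x| + 1)) * `|g x| + 1 * (e / (`|f x| + `|g x| + 1)).
  by rewrite [X in _ + X + _]mulrC -!mulrDl mulrC divfK// gt_eqF.
apply: ler_ltD.
  by apply: lerD; [rewrite ler_wpM2l// ltW | rewrite ler_wpM2r// ltW].
apply: ltr_pM => //.
Unshelve. all: by end_near. Qed.

End pointwise_product.

Definition CR (R : realType) (X : topologicalType) := continuousType X R^o.
Definition CC (R : realType) (X : topologicalType) :=
  continuousType X (Rcomplex R).

Notation "'C_R[' R ]( X )" := (CR R X)
  (format "'C_R[' R ]( X )") : type_scope.
Notation "'C[' R ]( X )" := (CC R X)
  (format "'C[' R ]( X )") : type_scope.

Section algebras.
Variables (R : realType) (X : topologicalType).

HB.instance Definition _ := GRing.Lmodule.on C_R[R](X).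
HB.instance Definition _ := GRing.Lmodule.on C[R](X).

Let mulR_cts (f g : C_R[R](X)) : continuous (fun x => f x * g x : R^o).
Proof.
by apply: ctsM_subproof => [a x y|a x y|x y];
   [apply: mulrBr | apply: mulrBl | apply: normrM].
Qed.

Let mulC_cts (f g : C[R](X)) : continuous (fun x => f x * g x : Rcomplex R).
Proof.
apply: ctsM_subproof => [a x y|a x y|x y];
   [apply: mulrBr | apply: mulrBl | exact: ComplexField.Normc.normcM].
Qed.

Definition CR_one : C_R[R](X) := cst (1 : R^o).
Definition CR_mul (f g : C_R[R](X)) : C_R[R](X) := mkcts (@mulR_cts f g).
Definition CC_one : C[R](X) := cst (1 : Rcomplex R).
Definition CC_mul (f g : C[R](X)) : C[R](X) := mkcts (@mulC_cts f g).

Let CR_mulA : associative CR_mul.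
Proof. by move=> f g h; apply/continuousEP => x; apply: mulrA. Qed.
Let CR_mulC : commutative CR_mul.
Proof. by move=> f g; apply/continuousEP => x; apply: mulrC. Qed.
Let CR_mul1 : left_id CR_one CR_mul.
Proof. by move=> f; apply/continuousEP => x; apply: mul1r. Qed.
Let CR_mulDl : left_distributive CR_mul +%R.
Proof. by move=> f g h; apply/continuousEP => x; apply: mulrDl. Qed.

Let CC_mulA : associative CC_mul.
Proof. by move=> f g h; apply/continuousEP => x; apply: mulrA. Qed.
Let CC_mulC : commutative CC_mul.
Proof. by move=> f g; apply/continuousEP => x; apply: mulrC. Qed.
Let CC_mul1 : left_id CC_one CC_mul.
Proof. by move=> f; apply/continuousEP => x; apply: mul1r. Qed.
Let CC_mulDl : left_distributive CC_mul +%R.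
Proof. by move=> f g h; apply/continuousEP => x; apply: mulrDl. Qed.

(* [X] may be empty, so these rings need not satisfy [1 != 0]. *)
HB.instance Definition _ := GRing.Zmodule_isComPzRing.Build C_R[R](X)
  CR_mulA CR_mulC CR_mul1 CR_mulDl.
HB.instance Definition _ := GRing.Zmodule_isComPzRing.Build C[R](X)
  CC_mulA CC_mulC CC_mul1 CC_mulDl.

End algebras.

HB.instance Definition _ (R : realType) (X : compactHausdorffType) :=
  NormedModule.on C_R[R](X).
HB.instance Definition _ (R : realType) (X : compactHausdorffType) :=
  NormedModule.on C[R](X).

Definition additive_map (A : zmodType) (T : A -> A) :=
  {morph T : f g / f + g}.

Definition multiplication (A : pzRingType) (T : A -> A) :=
  exists a, forall f, T f = a * f.

Definition zero_preserving (R : numFieldType) (X : topologicalType)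
    (V : normedModType R) (T : continuousType X V -> continuousType X V) :=
  forall (f : continuousType X V) (x : X), f x = 0 -> T f x = 0.

Definition upsilon_space (R : realType) (X : compactHausdorffType) :=
  forall T : C_R[R](X) -> C_R[R](X),
    additive_map T -> zero_preserving T -> multiplication T.

Section real_imaginary.
Variables (R : realType) (X : topologicalType).
Implicit Type f : C[R](X).

Let bound_continuous (h : Rcomplex R -> Rcomplex R) f :
  (forall z w, `|h z - h w| <= `|z - w|) -> continuous (fun x => h (f x)).
Proof.
move=> hle x.
have fx : f y @[y --> x] --> f x by apply: cts_fun.
apply/cvgrPdist_lt => e e0; near=> y.
apply: le_lt_trans (hle _ _) _.
by near: y; apply: cvgr_dist_lt.
Unshelve. all: by end_near. Qed.

Lemma ctsRe_subproof f : continuous (fun x => (complex.Re (f x))%:C : Rcomplex R).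
Proof.
apply: (@bound_continuous (fun z => (complex.Re z)%:C)) => -[a b] [c d].
rewrite /Num.norm /= subr0 expr0n addr0.
by rewrite ler_sqrt ?addr_ge0 ?sqr_ge0// lerDl sqr_ge0.
Qed.

Lemma ctsIm_subproof f : continuous (fun x => (complex.Im (f x))%:C : Rcomplex R).
Proof.
apply: (@bound_continuous (fun z => (complex.Im z)%:C)) => -[a b] [c d].
rewrite /Num.norm /= subr0 expr0n addr0.
by rewrite ler_sqrt ?addr_ge0 ?sqr_ge0// lerDr sqr_ge0.
Qed.

Definition ctsRe f : C[R](X) := mkcts (@ctsRe_subproof f).
Definition ctsIm f : C[R](X) := mkcts (@ctsIm_subproof f).
Definition ctsi : C[R](X) := cst ('i : Rcomplex R).

End real_imaginary.

(* Main.v *)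
Require Import Defs.
From HB Require Import structures.
From mathcomp Require Import all_boot all_order all_algebra.
From mathcomp Require Import all_classical all_reals topology normedtype.
Import Order.TTheory GRing.Theory Num.Theory.
Import numFieldNormedType.Exports.
Local Open Scope classical_set_scope.
Local Open Scope ring_scope.
Local Open Scope complex_scope.

(** A zero-preserving additive map acts fibrewise: [T f x] depends only on the
value [f x], because [T f x = T g x] whenever [f - g] vanishes at [x].  If such
a map on complex-valued functions is moreover real-linear, then comparing [f]
at [x] with the constant-coefficient combination
[Re (f x) *: 1 + Im (f x) *: 'i] gives
[T f x = Re (f x) *: T 1 x + Im (f x) *: T 'i x]
(lemma [linear_zero_preserving_pointwise]).  This is at once the formula
[T f = T 1 * Re f + T 'i * Im f] and the estimate
[`|T f| <= (`|T 1| + `|T 'i|) * `|f|], so real-linear maps are continuous.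
Conversely a continuous additive map between real normed spaces is real-linear,
since it commutes with rational scalars and these are dense
([continuous_additive_linear]).  Hence linearity, continuity and the formula are
equivalent as properties shared by all zero-preserving additive maps.

The link with real-valued functions goes through real and imaginary parts.  If
all zero-preserving additive maps on real-valued functions are multiplications,
then the four maps [Re (T u)], [Im (T u)], [Re (T ('i u))], [Im (T ('i u))] of
a real-valued [u] are multiplications, hence homogeneous, and so is [T]
([upsilon_real_linear]).  In the other direction a map [S] on real-valued
functions is tested on the complex map [f |-> S (Re f)], for which the formula
reads [S u = S 1 * u] on real [u] ([multiplication_of_complex_formula]). *)

Set Implicit Arguments.
Unset Strict Implicit.
Unset Printing Implicit Defensive.

(** * Additive maps and real scalars *)

Lemma raddfZ_rat (F : numFieldType) (V W : lmodType F) (T : {additive V -> W})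
  (q : rat) v : T (ratr q *: v) = ratr q *: T v.
Proof.
have d0 : (denq q)%:~R != 0 :> F by rewrite intr_eq0 denq_neq0.
apply: (scalerI d0); rewrite scalerA [_ * ratr q]mulrC.
rewrite !scaler_int -raddfMz -scaler_int scalerA /ratr mulrCA divff // mulr1.
by rewrite -mulrA mulVf // mulr1 !scaler_int raddfMz.
Qed.

(** The homogeneity defect [t |-> T (t *: v) - t *: T v] is continuous and
vanishes at rational [t], so the open set on which it does not vanish misses a
dense set. *)
Lemma continuous_additive_linear (R : realType) (V W : normedModType R)
  (T : V -> W) : {morph T : f g / f + g} -> continuous T -> linear T.
Proof.
move=> TD Tc.
have TB : zmod_morphism T.
  by move=> u v; apply: (addIr (T v)); rewrite -TD !subrK.
pose T' : {additive V -> W} :=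
  HB.pack T (GRing.isZmodMorphism.Build V W T TB).
suff TZ r v : T (r *: v) = r *: T v by move=> r u v; rewrite TD TZ.
pose defect (t : R) := T (t *: v) - t *: T v.
have defect_cts : continuous defect.
  move=> t; apply: cvgB; last exact: cvgZr_tmp.
  apply: continuous_comp; [exact: cvgZr_tmp | exact: Tc].
apply: contrapT => /eqP; rewrite -subr_eq0 => /eqP rv.
have [t [tv [q _ qt]]] : [set t | defect t <> 0] `&` range ratr !=set0.
  apply: dense_rat; first by exists r.
  apply: (@open_comp _ _ defect (~` [set 0])) => //.
  by rewrite openC; apply: accessible_closed_set1; apply: hausdorff_accessible.
apply: tv; rewrite -qt; apply/eqP; rewrite subr_eq0; apply/eqP.
exact: (raddfZ_rat T').
Qed.


(** * Real and imaginary parts *)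

Section complex_numbers.
Variable R : realType.
Implicit Types z w : Rcomplex R.

Lemma eq_Rcomplex z w :
  complex.Re z = complex.Re w -> complex.Im z = complex.Im w -> z = w.
Proof. by case: z w => [a b] [c d] /= -> ->. Qed.

Lemma Rcomplex_scaleE (r : R) z : r *: z = z * r%:C.
Proof.
case: z => a b; apply: eq_Rcomplex => /=.
  by rewrite mulr0 subr0 mulrC.
by rewrite mulr0 add0r mulrC.
Qed.

Lemma normr_Re z : `|complex.Re z| <= `|z|.
Proof.
case: z => a b; rewrite [leRHS]/Num.norm /= -[leLHS]sqrtr_sqr.
by rewrite ler_sqrt ?addr_ge0 ?sqr_ge0// lerDl sqr_ge0.
Qed.

Lemma normr_Im z : `|complex.Im z| <= `|z|.
Proof.
case: z => a b; rewrite [leRHS]/Num.norm /= -[leLHS]sqrtr_sqr.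
by rewrite ler_sqrt ?addr_ge0 ?sqr_ge0// lerDr sqr_ge0.
Qed.

End complex_numbers.

Section components.
Variables (R : realType) (X : topologicalType).
Implicit Types (f g : C[R](X)) (u v : C_R[R](X)).

Lemma cts_nonexpansive (V W : normedModType R) (h : V -> W)
    (f : continuousType X V) :
  (forall z w, `|h z - h w| <= `|z - w|) -> continuous (fun x => h (f x)).
Proof.
move=> hle x.
have fx : f y @[y --> x] --> f x by apply: cts_fun.
apply/cvgrPdist_lt => e e0; near=> y.
apply: le_lt_trans (hle _ _) _.
by near: y; apply: cvgr_dist_lt.
Unshelve. all: by end_near. Qed.

Let re_cts f : continuous (fun x => complex.Re (f x) : R^o).
Proof.
apply: (@cts_nonexpansive (Rcomplex R) R^o (@complex.Re R)) => z w.
by have := normr_Re (z - w); case: z w => [a b] [c d].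
Qed.

Let im_cts f : continuous (fun x => complex.Im (f x) : R^o).
Proof.
apply: (@cts_nonexpansive (Rcomplex R) R^o (@complex.Im R)) => z w.
by have := normr_Im (z - w); case: z w => [a b] [c d].
Qed.

Let ofR_cts u : continuous (fun x => (u x)%:C : Rcomplex R).
Proof.
apply: (@cts_nonexpansive R^o (Rcomplex R) (fun a => a%:C)) => a b.
by rewrite [leLHS]/Num.norm /= subr0 expr0n addr0 sqrtr_sqr.
Qed.

Definition cts_re f : C_R[R](X) := mkcts (@re_cts f).
Definition cts_im f : C_R[R](X) := mkcts (@im_cts f).
Definition cts_ofR u : C[R](X) := mkcts (@ofR_cts u).

Lemma cts_reD : {morph cts_re : f g / f + g}.
Proof. by move=> f g; apply/continuousEP => x; apply: raddfD. Qed.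

Lemma cts_imD : {morph cts_im : f g / f + g}.
Proof. by move=> f g; apply/continuousEP => x; apply: raddfD. Qed.

Lemma cts_ofRD : {morph cts_ofR : u v / u + v}.
Proof. by move=> u v; apply/continuousEP => x; apply: rmorphD. Qed.

Lemma cts_reZ r f : cts_re (r *: f) = r *: cts_re f.
Proof.
have ReZ (z : Rcomplex R) : complex.Re (r *: z) = r * complex.Re z by case: z.
by apply/continuousEP => x; apply: ReZ.
Qed.

Lemma cts_imZ r f : cts_im (r *: f) = r *: cts_im f.
Proof.
have ImZ (z : Rcomplex R) : complex.Im (r *: z) = r * complex.Im z by case: z.
by apply/continuousEP => x; apply: ImZ.
Qed.

Lemma cts_reK u : cts_re (cts_ofR u) = u.
Proof. exact/continuousEP. Qed.

Lemma cts_complexP f g : cts_re f = cts_re g -> cts_im f = cts_im g -> f = g.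
Proof.
move=> /continuousEP fg_re /continuousEP fg_im; apply/continuousEP => x.
exact: eq_Rcomplex (fg_re x) (fg_im x).
Qed.

Lemma cts_complexE f : f = cts_ofR (cts_re f) + ctsi R X * cts_ofR (cts_im f).
Proof.
apply/continuousEP => x.
apply: etrans (_ : (complex.Re (f x))%:C + 'i * (complex.Im (f x))%:C = _).
  exact: complexE.
by [].
Qed.

End components.

(** * Zero-preserving additive maps *)

Section zero_preserving_maps.
Variables (R : realType) (X : topologicalType).

(** [Re \o S] and [Im \o S] are zero-preserving maps of real-valued functions,
and a multiplication commutes with scalars; stated for maps into complex-valued
functions so as to apply both to [u |-> T u] and to [u |-> T ('i u)]. *)
Lemma upsilon_real_homogeneous (S : C_R[R](X) -> C[R](X)) :
    (forall S' : C_R[R](X) -> C_R[R](X),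
      additive_map S' -> zero_preserving S' -> multiplication S') ->
    {morph S : u v / u + v} -> (forall (u : C_R[R](X)) x, u x = 0 -> S u x = 0) ->
  forall (r : R) u, S (r *: u) = r *: S u.
Proof.
move=> upsilon SD S0 r u.
have homogeneous (S' : C_R[R](X) -> C_R[R](X)) :
    additive_map S' -> zero_preserving S' -> S' (r *: u) = r *: S' u.
  move=> S'D S'0; have [a aE] := upsilon _ S'D S'0.
  by rewrite !aE; apply/continuousEP => x; apply: mulrCA.
apply: cts_complexP.
  rewrite cts_reZ; apply: (homogeneous (@cts_re R X \o S)) => [v w|v x vx].
    by rewrite /= SD cts_reD.
  exact: (congr1 (@complex.Re R) (S0 v x vx)).
rewrite cts_imZ; apply: (homogeneous (@cts_im R X \o S)) => [v w|v x vx].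
  by rewrite /= SD cts_imD.
exact: (congr1 (@complex.Im R) (S0 v x vx)).
Qed.

Lemma upsilon_real_linear (T : C[R](X) -> C[R](X)) :
    (forall S : C_R[R](X) -> C_R[R](X),
      additive_map S -> zero_preserving S -> multiplication S) ->
    additive_map T -> zero_preserving T -> linear T.
Proof.
move=> upsilon TD T0.
suff TZ (r : R) f : T (r *: f) = r *: T f by move=> r f g; rewrite TD TZ.
have T_re : T (cts_ofR (r *: cts_re f)) = r *: T (cts_ofR (cts_re f)).
  apply: (upsilon_real_homogeneous (S := T \o @cts_ofR R X)) => //.
    by move=> u v; rewrite /= cts_ofRD TD.
  move=> u x ux; apply: T0.
  exact: (congr1 (fun a : R => a%:C) ux).
have T_im : T (ctsi R X * cts_ofR (r *: cts_im f)) =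
            r *: T (ctsi R X * cts_ofR (cts_im f)).
  apply: (upsilon_real_homogeneous
    (S := fun u => T (ctsi R X * cts_ofR u))) => //.
    by move=> u v; rewrite cts_ofRD mulrDr TD.
  move=> u x ux; apply: T0.
  rewrite -[LHS]/('i * (u x : R)%:C) ux.
  exact: mulr0.
by rewrite [in LHS] (cts_complexE (r *: f)) cts_reZ cts_imZ TD T_re T_im
  -scalerDr -TD -cts_complexE.
Qed.

(** The formula is applied to [f |-> S (Re f)], viewed as a complex-valued
function: at a real [u] the term in [Im u] disappears. *)
Lemma multiplication_of_complex_formula (S : C_R[R](X) -> C_R[R](X)) :
    (forall T : C[R](X) -> C[R](X), additive_map T -> zero_preserving T ->
      forall f, T f = T 1 * ctsRe f + T (ctsi R X) * ctsIm f) ->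
  additive_map S -> zero_preserving S -> multiplication S.
Proof.
move=> formula SD S0; exists (S 1) => u.
pose T f := cts_ofR (S (cts_re f)).
have TE : T (cts_ofR u) = T 1 * ctsRe (cts_ofR u)
                          + T (ctsi R X) * ctsIm (cts_ofR u).
  apply: formula => [f g|f x fx]; first by rewrite /T cts_reD SD cts_ofRD.
  have re_fx : cts_re f x = 0 := congr1 (@complex.Re R) fx.
  exact: (congr1 (fun a : R => a%:C) (S0 (cts_re f) x re_fx)).
have re1 : cts_re 1 = 1 :> C_R[R](X) by apply/continuousEP.
move: TE; rewrite /T cts_reK re1 => /continuousEP TE; apply/continuousEP => x.
have reE (a b c : R) : complex.Re (a%:C * b%:C + c%:C * 0%:C) = a * b.
  by rewrite mulr0 addr0 -rmorphM.
by rewrite [LHS] (congr1 (@complex.Re R) (TE x)) [LHS]reE.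
Qed.

(** The difference [h] between [f] and the combination of [1] and ['i] whose
scalar coefficients are the two parts of the single value [f x] vanishes at
[x], hence so does [T h], which linearity expands. *)
Lemma linear_zero_preserving_pointwise (T : C[R](X) -> C[R](X)) f x :
  linear T -> zero_preserving T ->
  T f x = complex.Re (f x) *: T 1 x + complex.Im (f x) *: T (ctsi R X) x.
Proof.
move=> Tlin T0.
pose T' : {linear C[R](X) -> C[R](X)} :=
  HB.pack T (GRing.isLinear.Build R _ _ _ T Tlin).
pose a := complex.Re (f x); pose b := complex.Im (f x).
pose h : C[R](X) := f - (a *: (1 : C[R](X)) + b *: ctsi R X).
have hx : h x = 0.
  rewrite -[LHS]/(f x - (a *: (1 : Rcomplex R) + b *: ('i : Rcomplex R))).
  apply/eqP; rewrite subr_eq0 /a /b; apply/eqP.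
  by case: (f x) => c d; apply: eq_Rcomplex => /=;
    rewrite mulr0 mulr1 (addr0, add0r).
have Th : T h = T f - (a *: T 1 + b *: T (ctsi R X)).
  by rewrite -[T]/(T' : _ -> _) linearB linearD !linearZ.
apply/eqP; rewrite -subr_eq0; apply/eqP.
by have := T0 h x hx; rewrite Th.
Qed.

Lemma linear_zero_preservingE (T : C[R](X) -> C[R](X)) f :
  linear T -> zero_preserving T ->
  T f = T 1 * ctsRe f + T (ctsi R X) * ctsIm f.
Proof.
move=> Tlin T0; apply/continuousEP => x.
by rewrite linear_zero_preserving_pointwise // !Rcomplex_scaleE.
Qed.

End zero_preserving_maps.

(** The pointwise formula bounds the operator norm of [T] by
[`|T 1| + `|T 'i|]. *)
Lemma linear_zero_preserving_continuous (R : realType)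
    (X : compactHausdorffType) (T : C[R](X) -> C[R](X)) :
  linear T -> zero_preserving T -> continuous T.
Proof.
move=> Tlin T0.
pose T' : {linear C[R](X) -> C[R](X)} :=
  HB.pack T (GRing.isLinear.Build R _ _ _ T Tlin).
apply: (@bounded_linear_continuous _ _ _ T'); apply/linear_boundedP.
near=> M => f.
have MT : `|T 1| + `|T (ctsi R X)| <= M.
  by near: M; apply: nbhs_pinfty_ge; rewrite num_real.
have M0 : 0 <= M by apply: le_trans MT; rewrite addr_ge0.
apply: sup_norm_le => [|x]; first by rewrite mulr_ge0.
have fx : `|f x| <= `|f| := sup_norm_ub f x.
rewrite -[T' f]/(T f) linear_zero_preserving_pointwise //.
apply: le_trans (ler_normD _ _) _; rewrite !normrZ.
apply: (@le_trans _ _ (`|f| * `|T 1| + `|f| * `|T (ctsi R X)|)).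
  apply: lerD; apply: ler_pM => //.
  - exact: le_trans (normr_Re _) fx.
  - exact: (sup_norm_ub (T 1)).
  - exact: le_trans (normr_Im _) fx.
  - exact: (sup_norm_ub (T (ctsi R X))).
by rewrite -mulrDr mulrC ler_wpM2r.
Unshelve. all: by end_near. Qed.

Theorem theorem10 (R : realType) (X : compactHausdorffType) :
  [<->
    (* (1) *) upsilon_space R X;
    (* (2) *) forall T : C[R](X) -> C[R](X),
      additive_map T -> zero_preserving T -> linear T;
    (* (3) *) forall T : C[R](X) -> C[R](X),
      additive_map T -> zero_preserving T -> continuous T;
    (* (4) *) forall T : C[R](X) -> C[R](X),
      additive_map T -> zero_preserving T ->
      forall f : C[R](X), T f = T 1 * ctsRe f + T (ctsi R X) * ctsIm f;
    (* (5) *) forall T : C_R[R](X) -> C_R[R](X),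
      additive_map T -> zero_preserving T -> multiplication T
  ].
Proof.
tfae.
- by move=> upsilon T; apply: upsilon_real_linear.
- move=> Tlin T TD T0.
  exact: linear_zero_preserving_continuous (Tlin _ TD T0) T0.
- move=> Tcts T TD T0 f; apply: linear_zero_preservingE => //.
  exact: continuous_additive_linear TD (Tcts _ TD T0).
- by move=> formula T; apply: multiplication_of_complex_formula.
- by [].
Qed.
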